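(* Let $[a,b]$, $\alpha$, $\beta$, $A$, $\bar A$ be as in the context. Let $x:[a,b]\to\mathbb{R}$ be a continuous function and $y:[a,b]\to\mathbb{R}$ a continuously differentiable function. Then $$\int_a^b x(t)\;{}^{A}_{C}D^{\alpha,\beta}_{a+}y(t)\,dt=\Bigl[\,y(t)\;{}^{\bar A}I^{1-\alpha,\beta}_{b-}x(t)\Bigr]_{a}^{b}+\int_a^b y(t)\;{}^{A}_{RL}D^{\alpha,\beta}_{b-}x(t)\,dt.$$
   Context: Let $[a,b]$ be a real interval, $\alpha\in[0,1]$ a real parameter, $\beta$ a complex parameter with non-negative real part, and $R$ a positive number with $R>(b-a)^{\mathrm{Re}(\beta)}$. Let $A$ be a complex analytic function on the disc $D(0,R)$, given there by the locally uniformly convergent power series $A(x)=\sum_{n=0}^{\infty}a_nx^n$. The left and right-sided fractional integrals of order $\alpha$ with general analytic kernel $A$ are $${}^{A}I^{\alpha,\beta}_{a+}x(t)=\int_a^t(t-s)^{\alpha-1}A\bigl((t-s)^{\beta}\bigr)x(s)\,ds,\qquad {}^{A}I^{\alpha,\beta}_{b-}x(t)=\int_t^b(s-t)^{\alpha-1}A\bigl((s-t)^{\beta}\bigr)x(s)\,ds.$$ For an analytic function $A$ used in an operator of order $\alpha$, put $A_\Gamma(x)=\sum_{n\ge0}a_n\Gamma(\beta n+\alpha)x^n$. Let $\bar A(x)=\sum_{n\ge0}\bar a_nx^n$ be the analytic function with $A_\Gamma\cdot\bar A_\Gamma=1$, where, $\bar A$ being used in operators of order $1-\alpha$, $\bar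 A_\Gamma(x)=\sum_{n\ge0}\bar a_n\Gamma(\beta n+1-\alpha)x^n$. The left Caputo and right Riemann--Liouville fractional derivatives with general analytic kernel are $${}^{A}_{C}D^{\alpha,\beta}_{a+}y(t)={}^{\bar A}I^{1-\alpha,\beta}_{a+}y'(t),\qquad {}^{A}_{RL}D^{\alpha,\beta}_{b-}x(t)=-\frac{d}{dt}\Bigl({}^{\bar A}I^{1-\alpha,\beta}_{b-}x(t)\Bigr),$$ for functions with sufficient differentiability properties for these to be defined. *)

(* Defs.v *)
(* MathComp-Analysis, with complex numbers from mathcomp-real-closed *)
From mathcomp Require Export all_boot all_order all_algebra.
From mathcomp Require Export complex.
From mathcomp Require Export all_classical all_reals all_analysis.
Export Order.TTheory GRing.Theory Num.Theory numFieldNormedType.Exports.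

Set Implicit Arguments.
Unset Strict Implicit.
Unset Printing Implicit Defensive.

Local Open Scope classical_set_scope.
Local Open Scope ring_scope.
Local Open Scope complex_scope.

Definition power_series_on (K : numFieldType) (r : K) (c : nat -> K)
    (F : K -> K) : Prop :=
  forall z0 : K, `|z0| < r -> exists2 U : set K, nbhs z0 U &
    {uniform U, (fun N (z : K) => \sum_(0 <= n < N) c n * z ^+ n) @ \oo --> F}.

Section complex_calculus.
Context {R : realType}.
Implicit Types (D : set R) (f : R -> R[i]) (t u : R) (z : R[i]).

Definition cintegrable D f : Prop :=
  (@lebesgue_measure R).-integrable D (EFin \o (@complex.Re R \o f)) /\
  (@lebesgue_measure R).-integrable D (EFin \o (@complex.Im R \o f)).

Definition cintegral D f : R[i] :=
  (\int[@lebesgue_measure R]_(s in D) complex.Re (f s)) +i*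
  (\int[@lebesgue_measure R]_(s in D) complex.Im (f s)).

Definition cderivable f t : Prop :=
  derivable (@complex.Re R \o f) t 1 /\ derivable (@complex.Im R \o f) t 1.

Definition cderive f t : R[i] :=
  derive1 (@complex.Re R \o f) t +i* derive1 (@complex.Im R \o f) t.

(* Principal value of u ^ z = u ^ (Re z) * exp (i Im z ln u) for u > 0. The
   value at u = 0 is only ever used on null sets. *)
Definition cpow u z : R[i] :=
  (u `^ complex.Re z)%:C *
  (cos (complex.Im z * ln u) +i* sin (complex.Im z * ln u)).

Definition euler_integral z : R[i] :=
  cintegral `[0, +oo[ (fun u => cpow u (z - 1) * (expR (- u))%:C).

(* Gamma on the half-plane Re z > -1, through Gamma (z + 1) = z Gamma z. The
   imaginary axis is needed, since Re beta may vanish; at the pole z = 0 the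
   value is 0, as division by zero is. *)
Definition Gamma z : R[i] :=
  if 0 < complex.Re z then euler_integral z else euler_integral (z + 1) / z.

(* The derivative of y on [a, b] is one-sided at the endpoints. *)
Definition C1_on (a b : R) (y : R -> R) : Prop :=
  exists2 dy : R -> R, {within `[a, b], continuous dy} &
    forall t, t \in `[a, b] ->
      (fun s => (y s - y t) / (s - t)) @ within `[a, b] t^' --> dy t.

End complex_calculus.

Section general_analytic_kernel.
Context {R : realType}.
Implicit Types (a b alpha t : R) (beta : R[i]) (c : nat -> R[i])
  (A Abar : R[i] -> R[i]) (x y : R -> R).

Definition frac_int_left a alpha beta A x t : R[i] :=
  cintegral `[a, t] (fun s =>
    ((t - s) `^ (alpha - 1))%:C * A (cpow (t - s) beta) * (x s)%:C).

Definition frac_int_right b alpha beta A x t : R[i] :=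
  cintegral `[t, b] (fun s =>
    ((s - t) `^ (alpha - 1))%:C * A (cpow (s - t) beta) * (x s)%:C).

(* Coefficients of the series A_Gamma, for A = \sum_n c_n z ^ n. *)
Definition gamma_coef alpha beta c (n : nat) : R[i] :=
  c n * Gamma (beta * n%:R + alpha%:C).

(* A_Gamma * Abar_Gamma = 1 as a product of power series: in general these
   series have radius of convergence 0. At alpha = 0 or alpha = 1 the constant
   terms involve Gamma 0 and the relation has no solution. *)
Definition conjugate_kernels alpha beta (c cbar : nat -> R[i]) : Prop :=
  forall n : nat,
    \sum_(k < n.+1) gamma_coef alpha beta c k *
                    gamma_coef (1 - alpha) beta cbar (n - k)%N
    = (n == 0%N)%:R.

(* The derivatives below are those of the operator with kernel A; only its
   conjugate Abar enters the formulas. *)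
Definition caputo_left a alpha beta Abar y t : R[i] :=
  frac_int_left a (1 - alpha) beta Abar (derive1 y) t.

Definition RL_right b alpha beta Abar x t : R[i] :=
  - cderive (frac_int_right b (1 - alpha) beta Abar x) t.

(* The Riemann-Liouville derivative of a merely continuous x need not exist. *)
Definition RL_right_defined a b alpha beta Abar x : Prop :=
  forall t, t \in `]a, b[ ->
    cderivable (frac_int_right b (1 - alpha) beta Abar x) t.

End general_analytic_kernel.

(* Main.v *)
(* Integrating [x] against the Caputo derivative and exchanging the order of
   integration (Fubini for the convolution with the integrable kernel
   [k u = u ^ (- alpha) * Abar (u ^ beta)]) gives the integral of [y' * F], where
   [F] is the right fractional integral of [x].  It remains to integrate
   [(y * F)' = y' * F + y * F'] over [[a, b]].  As [x] is only continuous, [F'] is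
   defined everywhere on []a, b[] but need not be continuous, so this step uses
   the fundamental theorem of calculus for an everywhere differentiable function
   with Lebesgue integrable derivative, proved with a lower semicontinuous
   majorant of the derivative (Vitali-Caratheodory). *)
From HB Require Import structures.
Require Import Defs.
From mathcomp Require Import measurable_realfun lra ring.

Set Implicit Arguments.
Unset Strict Implicit.
Unset Printing Implicit Defensive.

Local Open Scope classical_set_scope.
Local Open Scope ring_scope.
Local Open Scope complex_scope.

Local Notation mu := lebesgue_measure.

(** * The fundamental theorem of calculus for integrable derivatives *)

Lemma right_increasing_le (R : realType) (a b : R) (f : R -> R) : a < b ->
  {within `[a, b], continuous f} ->
  (forall x, a < x < b -> \forall z \near x^'+, f x <= f z) ->
  f a <= f b.
Proof.
move=> ab /(continuous_within_itvP _ ab)[cf fa fb] fle.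
suff main c : a < c < b -> f c <= f b.
  apply: (cvgr_to_le fa).
  near=> c; apply: main; apply/andP; split.
    by near: c; exact: nbhs_right_gt.
  by near: c; exact: nbhs_right_lt.
move=> /andP[ac cb]; rewrite leNgt; apply/negP => fbc.
pose S := [set t | c <= t <= b /\ f c <= f t].
have Sc : S c by split=> //; rewrite lexx ltW.
have supS : has_sup S.
  by split; [exists c|exists b => t [/andP[_ ->]]].
set s := sup S.
have cs : c <= s by exact: sup_upper_bound.
have sb : s <= b by apply: ge_sup; [exists c|move=> t [/andP[_ ->]]].
have as_ : a < s by exact: lt_le_trans cs.
have fcs : f c <= f s.
  rewrite leNgt; apply/negP => fsc.
  have : \forall t \near s^'-, f t < f c.
    have : f t @[t --> s^'-] --> f s.
      move: sb; rewrite le_eqVlt => /predU1P[->//|sb].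
      by apply: cvg_at_left_filter; apply: cf; rewrite in_itv/= as_.
    by move=> /cvgr_lt; exact.
  move=> [e /= e0 He].
  have [t [tcb ct] st] := sup_adherent e0 supS.
  have ts : t <= s by exact: sup_upper_bound.
  have [tes|ts'] := eqVneq t s; first by move: ct; rewrite tes leNgt fsc.
  have tls : t < s by rewrite lt_neqAle ts'.
  suff : f t < f c by rewrite ltNge ct.
  apply: He => //=; rewrite gtr0_norm ?subr_gt0//; rewrite -/s in st; lra.
have [sEb|sNb] := eqVneq s b.
  by move: fcs; rewrite sEb leNgt fbc.
have slb : s < b by rewrite lt_neqAle sNb.
have : \forall z \near s^'+, f s <= f z by apply: fle; rewrite as_.
move=> fsz.
have : \forall z \near s^'+, False.
  near=> z.
  have sz : s < z by near: z; exact: nbhs_right_gt.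
  have : S z.
    split.
      rewrite (le_trans cs (ltW sz))/=; near: z; exact: nbhs_right_le.
    by apply: (le_trans fcs); near: z.
  by move=> /(sup_upper_bound supS); rewrite -/s leNgt sz.
by case/filter_ex.
Unshelve. all: by end_near. Qed.

Lemma lower_semicontinuous_majorant (R : realType) (D : set R) (f : R -> R)
    (e : R) :
  measurable D -> (mu D < +oo)%E -> measurable_fun D f ->
  (forall x, D x -> 0 <= f x) -> 0 < e ->
  exists g : R -> \bar R, [/\ measurable_fun setT g, forall x, (0 <= g x)%E,
    (\int[mu]_(x in D) g x <= \int[mu]_(x in D) (f x)%:E + e%:E)%E &
    forall x, D x -> \forall z \near x, ((f x)%:E <= g z)%E].
Proof.
move=> mD Doo mf f0 e0.
have e20 : 0 < e / 2 by rewrite divr_gt0.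
have muD0 : 0 <= fine (mu D) by rewrite fine_ge0.
have muDE : mu D = (fine (mu D))%:E by rewrite fineK// ge0_fin_numE.
have mfE : measurable_fun D (fun x => (f x)%:E : \bar R).
  exact/measurable_EFinP.
pose d := e / 2 / (fine (mu D) + 1).
have d0 : 0 < d by rewrite divr_gt0// ltr_wpDl.
have dD : d * fine (mu D) <= e / 2.
  by rewrite /d mulrAC ler_pdivrMr ?ltr_wpDl// ler_wpM2l ?lerDl// ltW.
pose c (k : nat) := k.+1%:R * d.
have c0 k : 0 < c k by rewrite mulr_gt0.
pose E (k : nat) := D `&` f @^-1` `[k%:R * d, c k[.
have mE k : measurable (E k) by exact: mf.
have EDoo k : (mu (E k) < +oo)%E.
  apply: le_lt_trans Doo; apply: le_measure; rewrite ?inE.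
  - exact: mE.
  - exact: mD.
  - by move=> x [].
pose r (k : nat) := e / 2 / (2 ^ k.+1)%:R / c k.
have r0 k : 0 < r k by rewrite !divr_gt0// ltr0n expn_gt0.
have /choice[U UP] : forall k, exists U : set R,
    [/\ open U, E k `<=` U & (mu (U `\` E k) < (r k)%:E)%E].
  by move=> k; exact: (lebesgue_regularity_outer (mE k) (EDoo k) (r0 k)).
have mU k : measurable (U k) by apply: open_measurable; case: (UP k).
pose t (k : nat) (x : R) : \bar R := ((c k)%:E * (\1_(U k) x)%:E)%E.
have t0 k x : (0 <= t k x)%E by apply: mule_ge0; rewrite lee_fin // ltW.
have mI k : measurable_fun setT (fun x => (\1_(U k) x)%:E : \bar R).
  by apply/measurable_EFinP; exact: (measurable_indic (mU k)).
have mt k : measurable_fun setT (t k).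
  exact: measurable_funeM.
have mtD k : measurable_fun D (t k) by exact: measurable_funTS.
have Ecell x : D x -> E (Num.truncn (f x / d)) x.
  move=> Dx; split => //=; rewrite in_itv/= /c.
  rewrite -ler_pdivlMr// -ltr_pdivrMr//.
  by apply: truncn_itv; rewrite divr_ge0 ?f0// ltW.
have DE : D = \bigcup_k E k.
  apply/seteqP; split => [x Dx|x [k _ []//]].
  by exists (Num.truncn (f x / d)) => //; exact: Ecell.
have tE : trivIset setT E.
  apply/trivIsetP => i j _ _ ij; rewrite -subset0 => x [[Dx]].
  rewrite /= !in_itv/= => /andP[fi1 fi2] [_ /andP[]]; rewrite !bnd_simp => fj1 fj2.
  move: ij; apply/negP; rewrite negbK eqn_leq; apply/andP; split.
    have := le_lt_trans fi1 fj2; rewrite ltr_pM2r// ltr_nat ltnS; exact.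
  by have := le_lt_trans fj1 fi2; rewrite ltr_pM2r// ltr_nat ltnS; exact.
exists (fun x => \sum_(0 <= k <oo) t k x)%E; split.
- by apply: ge0_emeasurable_sum.
- by move=> x; exact: nneseries_ge0.
- rewrite integral_nneseries//.
  apply: (@le_trans _ _ (\sum_(0 <= k <oo) ((c k)%:E * mu (E k) +
      (e / 2 / (2 ^ k.+1)%:R)%:E))%E).
    apply: lee_nneseries => k _.
      by move=> _; apply: integral_ge0.
    rewrite ge0_integralZl//=; last 2 first.
    + exact: (measurable_funTS (mI k)).
    + by rewrite lee_fin ltW.
    rewrite integral_indic; [|exact: mD|exact: mU].
    have [oU EU muU] := UP k.
    have -> : (e / 2 / (2 ^ k.+1)%:R)%:E = ((c k)%:E * (r k)%:E)%E.
      by rewrite -EFinM /r mulrCA divff ?mulr1// gt_eqF.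
    rewrite -muleDr//=; last first.
      by apply: ge0_adde_def; rewrite inE// lee_fin ltW.
    apply: lee_pmul => //; first by rewrite lee_fin ltW.
    apply: (@le_trans _ _ (mu (U k))).
      apply: le_measure; last exact: subIsetl.
        by rewrite inE; apply: measurableI; [exact: mU|exact: mD].
      by rewrite inE; exact: mU.
    have := @measureU _ _ _ (@lebesgue_measure R) (E k) (U k `\` E k).
    rewrite (setDUK EU) => ->; [by rewrite leeD2l// ltW|exact: mE| |].
    - by apply: measurableD; [exact: mU|exact: mE].
    - exact: setDIK.
  apply: (le_trans (epsilon_trick _ _ _)) => //.
  + by move=> k; rewrite mule_ge0// lee_fin ltW.
  + by rewrite ltW.
  have -> : e%:E = ((e / 2)%:E + (e / 2)%:E)%E by rewrite -EFinD -splitr.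
  rewrite addeA leeD2r//.
  apply: (@le_trans _ _ (\int[mu]_(x in D) ((f x)%:E + d%:E))%E); last first.
    rewrite ge0_integralD//; last first.
    by move=> x _; rewrite lee_fin ltW.
    rewrite integral_cst; last exact: mD.
    by rewrite leeD2l// [X in (_ * X)%E]muDE -EFinM lee_fin.
  rewrite [in leRHS]DE ge0_integral_bigcup//; last 2 first.
  + by rewrite -DE; apply: emeasurable_funD; [exact: mfE|exact: measurable_cst].
  + by rewrite -DE => x Dx; rewrite adde_ge0// lee_fin ?f0// ltW.
  apply: lee_nneseries => k _; first by move=> _; rewrite mule_ge0// lee_fin ltW.
  apply: (@le_trans _ _ (\int[mu]_(x in E k) (c k)%:E)%E).
    by rewrite integral_cst; last exact: mE.
  apply: ge0_le_integral; [exact: mE| | | |].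
  + by move=> x _; rewrite lee_fin ltW.
  + exact: measurable_cst.
  + apply: emeasurable_funD; last exact: measurable_cst.
    apply: (measurable_funS _ _ mfE); [exact: mD|exact: subIsetl].
  + move=> x [Dx /=]; rewrite in_itv/= => /andP[+ _].
    rewrite -EFinD lee_fin /c -natr1 mulrDl mul1r => h; by rewrite lerD2r.
- move=> x Dx; set k := Num.truncn (f x / d).
  have [oU EU _] := UP k.
  have : nbhs x (U k) by apply: open_nbhs_nbhs; split => //; exact/EU/Ecell.
  apply: filterS => z Uz.
  apply: le_trans (@nneseries_lim_ge _ (t ^~ z) xpredT 0 k.+1 _) => //.
  rewrite big_nat_recr//= addeC; apply: le_trans (leeDl _ _); last first.
    by apply: sume_ge0.
  rewrite /t indicE mem_set// mule1 lee_fin.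
  by have [_ /=] := Ecell _ Dx; rewrite in_itv/= => /andP[_ /ltW].
Qed.

Lemma ler_norm_maxrN (R : realDomainType) (y m : R) : 0 <= m ->
  `|Num.max y (- m)| <= `|y|.
Proof.
move=> m0; case: (leP y (- m)) => // ym.
rewrite normrN ger0_norm// ler0_norm 1?lerNr//.
by rewrite (le_trans ym)// oppr_le0.
Qed.

Lemma integral_maxrN_le (R : realType) (a b : R) (f : R -> R) (e : R) :
  mu.-integrable `[a, b] (EFin \o f) -> 0 < e ->
  exists n : nat, (\int[mu]_(x in `[a, b]) (Num.max (f x) (- n%:R))%:E <=
    \int[mu]_(x in `[a, b]) (f x)%:E + e%:E)%E.
Proof.
move=> fi e0.
have mf : measurable_fun `[a, b] f by apply/measurable_EFinP; exact: measurable_int fi.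
have mfn (n : nat) : measurable_fun `[a, b] (fun x => Num.max (f x) (- n%:R)).
  by apply: measurable_maxr => //; exact: measurable_cst.
have ifabs : mu.-integrable `[a, b] (abse \o (EFin \o f)).
  exact: (integrable_abse fi).
have mfnE n : measurable_fun `[a, b]
    (fun x => (Num.max (f x) (- n%:R))%:E : \bar R) by exact/measurable_EFinP.
have [] := @dominated_convergence _ _ _ (@lebesgue_measure R) `[a, b]
  (measurable_itv _) (fun n x => (Num.max (f x) (- n%:R))%:E) (EFin \o f)
  (abse \o (EFin \o f)).
- exact: mfnE.
- exact: measurable_int fi.
- apply: aeW => x _ /=; apply: cvg_EFin; first exact: nearW.
  apply: (@cvg_near_cst); near=> n; apply/max_idPl.
  rewrite lerNl.
  near: n; exact: nbhs_infty_ger.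
- exact: ifabs.
- apply: aeW => x n _ /=; rewrite lee_fin; exact: ler_norm_maxrN.
move=> _ _ cv.
have fin : (\int[mu]_(x in `[a, b]) (f x)%:E)%E \is a fin_num.
  exact: integrable_fin_num fi.
have lt : (\int[mu]_(x in `[a, b]) (f x)%:E <
    \int[mu]_(x in `[a, b]) (f x)%:E + e%:E)%E.
  by rewrite lteDl// lte_fin.
have /filter_ex[n] : \forall n \near \oo,
    (\int[mu]_(x in `[a, b]) (Num.max (f x) (- n%:R))%:E <
     \int[mu]_(x in `[a, b]) (f x)%:E + e%:E)%E.
  exact: (cv _ (open_nbhs_nbhs (conj (@open_ereal_lt_ereal _ _) lt))).
by move=> /ltW ?; exists n.
Unshelve. all: by end_near. Qed.

(* [G] is a primitive of [g - n], where [g] is a lower semicontinuous majorant of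
   [max f (- n) + n] and [n] is large. *)
Lemma vitali_caratheodory (R : realType) (a b : R) (f : R -> R) (e : R) :
  a < b -> mu.-integrable `[a, b] (EFin \o f) -> 0 < e ->
  exists G : R -> R, [/\ {within `[a, b], continuous G},
    G b - G a <= \int[mu]_(x in `[a, b]) f x + e &
    forall x, a < x < b -> \forall z \near x^'+, (z - x) * f x <= G z - G x].
Proof.
move=> ab fi e0; have e20 : 0 < e / 2 by rewrite divr_gt0.
have mf : measurable_fun `[a, b] f by apply/measurable_EFinP; exact: measurable_int fi.
have [n fn] := integral_maxrN_le fi e20.
pose fm x := Num.max (f x) (- n%:R).
have mfm : measurable_fun `[a, b] fm by apply: measurable_maxr => //; exact: measurable_cst.
have ffin : (\int[mu]_(x in `[a, b]) (f x)%:E)%E \is a fin_num.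
  exact: integrable_fin_num fi.
have muab : (mu `[a, b] = (b - a)%:E)%E.
  by rewrite [LHS]lebesgue_measure_itv/= lte_fin ab -EFinD.
have icst : mu.-integrable `[a, b] (EFin \o cst n%:R : R -> \bar R).
  apply: continuous_compact_integrable; first exact: segment_compact.
  by apply: continuous_subspaceT => x; exact: cvg_cst.
have ifm : mu.-integrable `[a, b] (EFin \o fm).
  have mfmE : measurable_fun `[a, b] (EFin \o fm) by exact/measurable_EFinP.
  apply: (@le_integrable _ (measurableTypeR R) R mu _ _ _ (EFin \o f)) => //.
  by move=> x _ /=; rewrite lee_fin; exact: ler_norm_maxrN.
have [] := @lower_semicontinuous_majorant R `[a, b] (fun x => fm x + n%:R) (e / 2).
- exact: measurable_itv.
- by rewrite muab ltry.
- by apply: measurable_funD => //; exact: measurable_cst.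
- by move=> x _; rewrite -lerBlDr sub0r le_max lexx orbT.
- by [].
move=> g [mg g0 intg gnear].
have mgab : measurable_fun `[a, b] g by exact: measurable_funTS.
have intE : (\int[mu]_(x in `[a, b]) (fm x + n%:R)%:E =
   \int[mu]_(x in `[a, b]) (fm x)%:E + (n%:R * (b - a))%:E)%E.
  under eq_integral do rewrite EFinD.
  by rewrite integralD//= integral_cst//= [X in (_ + _ * X)%E]muab.
have gi : mu.-integrable `[a, b] g.
  apply/integrableP; split=> //.
  under eq_integral do rewrite gee0_abs//.
  apply: (le_lt_trans intg); rewrite intE.
  by rewrite lte_add_pinfty ?ltry// lte_add_pinfty ?ltry//; apply: integrable_lty.
pose h := fine \o g.
have mh : measurable_fun setT h by apply: measurableT_comp => //; exact: measurable_fine.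
have hi : mu.-integrable `[a, b] (EFin \o h).
  have mhE : measurable_fun `[a, b] (EFin \o h).
    by apply/measurable_EFinP; exact: measurable_funTS.
  apply: (@le_integrable _ (measurableTypeR R) R mu _ _ _ g) => //.
  by move=> x _; rewrite /h /=; case: (g x) => //= ; rewrite normr0 leey.
have hg s t : a <= s -> t <= b ->
    (\int[mu]_(x in `]s, t]) (h x)%:E = \int[mu]_(x in `]s, t]) g x)%E.
  move=> as_ tb; have st : `]s, t] `<=` `[a, b].
    move=> x /=; rewrite !in_itv/= => /andP[sx xt].
    by rewrite (le_trans as_ (ltW sx)) (le_trans xt tb).
  apply: ae_eq_integral => //.
  - by apply/measurable_EFinP; exact: measurable_funTS.
  - exact: measurable_funTS.
  - have := @integrable_ae _ (measurableTypeR R) R mu _ (measurable_itv _) _ gi.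
    by apply: filterS => x /= gx xst; rewrite /h/= fineK//; apply: gx; exact: st.
have hB x z : a <= x -> x <= z -> z <= b ->
   (\int[mu]_(t in `[a, z]) h t - \int[mu]_(t in `[a, x]) h t =
    fine (\int[mu]_(t in `]x, z]) g t)%E).
  move=> ax xz zb; rewrite Rintegral_itvB//.
  - by rewrite /Rintegral hg.
  - by apply: integrableS hi => // t /=; rewrite !in_itv/= => /andP[-> tz]; exact: le_trans zb.
have gfin s t : a <= s -> t <= b -> (\int[mu]_(x in `]s, t]) g x)%E \is a fin_num.
  move=> as_ tb; apply: integrable_fin_num; first exact: measurable_itv.
  apply: (@integrableS _ (measurableTypeR R) R mu `[a, b]) => //.
  move=> x /=; rewrite !in_itv/= => /andP[sx xt].
  by rewrite (le_trans as_ (ltW sx)) (le_trans xt tb).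
have clin : {within `[a, b], continuous (fun s : R => n%:R * (s - a))}.
  apply: continuous_subspaceT => s; apply: cvgM; first exact: cvg_cst.
  by apply: cvgB; [exact: cvg_id|exact: cvg_cst].
exists (fun s => \int[mu]_(t in `[a, s]) h t - n%:R * (s - a)); split.
- move=> s; apply: cvgB.
    exact: (@parameterized_integral_continuous R a b h (ltW ab) hi s).
  exact: (clin s).
- rewrite subrr mulr0 subr0 addrAC hB; [|exact: lexx|exact: ltW|exact: lexx].
  rewrite lerBlDr -lee_fin fineK; last exact: gfin.
  apply: (@le_trans _ _ (\int[mu]_(x in `[a, b]) g x)%E).
    apply: (@ge0_subset_integral _ (measurableTypeR R) R mu) => //.
    by move=> x /=; rewrite !in_itv/= => /andP[/ltW ->].
  apply: (le_trans intg); rewrite intE.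
  apply: (@le_trans _ _ (\int[mu]_(x in `[a, b]) (f x)%:E + (e / 2)%:E +
     (n%:R * (b - a))%:E + (e / 2)%:E)%E).
    by rewrite leeD2r// leeD2r.
  rewrite /Rintegral -[X in (X + _ + _ + _ <= _)%E](fineK ffin) -!EFinD lee_fin.
  by rewrite [X in _ <= _ + X + _]splitr; lra.
- move=> x /andP[ax xb]; have /gnear : `[a, b]%classic x by rewrite /= in_itv/= !ltW.
  move=> [d /= d0 dg].
  near=> z.
  have xz : x < z by near: z; exact: nbhs_right_gt.
  have zb : z <= b by near: z; exact: nbhs_right_le.
  have zd : z - x < d by rewrite ltrBlDl; near: z; apply: nbhs_right_lt; rewrite ltrDl.
  have -> : forall p q r u : R, p - n%:R * q - (r - n%:R * u) = p - r - n%:R * (q - u).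
    by move=> *; ring.
  rewrite hB; [|exact: ltW|exact: ltW|exact: zb].
  have -> : z - a - (x - a) = z - x by ring.
  rewrite lerBrDr -lee_fin fineK; last by apply: gfin => //; exact: ltW.
  have muxz : (mu `]x, z] = (z - x)%:E)%E.
    by rewrite [LHS]lebesgue_measure_itv/= lte_fin xz -EFinD.
  apply: (@le_trans _ _ (\int[mu]_(t in `]x, z]) (fm x + n%:R)%:E)%E).
    rewrite integral_cst//= [X in (_ * X)%E]muxz -EFinM lee_fin.
    by rewrite [(z - x) * f x]mulrC -mulrDl ler_wpM2r ?subr_ge0 ?(ltW xz)// lerD2r le_max lexx.
  apply: (@ge0_le_integral _ (measurableTypeR R) R mu) => //.
  - by move=> t _; rewrite lee_fin -lerBlDr sub0r le_max lexx orbT.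
  - exact: measurable_funTS.
  - move=> t /=; rewrite in_itv/= => /andP[xt tz]; apply: dg => /=.
    by rewrite ltr0_norm ?subr_lt0// opprB (le_lt_trans _ zd)// lerB.
Unshelve. all: by end_near. Qed.

Lemma derivable_integrable_le (R : realType) (a b : R) (f h : R -> R) : a < b ->
  {within `[a, b], continuous h} ->
  (forall x, a < x < b -> is_derive x 1 h (f x)) ->
  mu.-integrable `[a, b] (EFin \o f) ->
  h b - h a <= \int[mu]_(x in `[a, b]) f x.
Proof.
move=> ab ch dh fi; apply/ler_addgt0Pr => e e0.
have ba0 : 0 < 1 + (b - a) by rewrite ltr_pwDl// subr_ge0 ltW.
pose d := e / (1 + (b - a)).
have d0 : 0 < d by rewrite divr_gt0.
have [G [cG Gab Gle]] := vitali_caratheodory ab fi d0.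
have clin : {within `[a, b], continuous (fun s : R => d * (s - a))}.
  apply: continuous_subspaceT => s; apply: cvgM; first exact: cvg_cst.
  by apply: cvgB; [exact: cvg_id|exact: cvg_cst].
have : G a - h a + d * (a - a) <= G b - h b + d * (b - a).
  apply: (@right_increasing_le R a b (fun s => G s - h s + d * (s - a)) ab).
    by move=> s; apply: cvgD; [apply: cvgB; [exact: cG|exact: ch]|exact: clin].
  move=> x axb; have [dhx hx] := dh x axb.
  have : (fun t : R => t^-1 *: (h (t *: 1 + x) - h x)) @ 0^' --> f x.
    by rewrite -hx; exact: dhx.
  move=> /cvgr_lt /(_ (f x + d)); rewrite ltrDl => /(_ d0) [/= r r0 hr].
  near=> z.
  have xz : x < z by near: z; exact: nbhs_right_gt.
  have zr : z - x < r by rewrite ltrBlDl; near: z; apply: nbhs_right_lt; rewrite ltrDl.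
  have zx0 : 0 < z - x by rewrite subr_gt0.
  have Gz : (z - x) * f x <= G z - G x by near: z; exact: Gle.
  have : (z - x)^-1 *: (h ((z - x) *: 1 + x) - h x) < f x + d.
    by apply: hr; rewrite ?gt_eqF//= sub0r normrN gtr0_norm.
  rewrite /GRing.scale/= mulr1 subrK mulrC ltr_pdivrMr// => hz.
  by lra.
rewrite subrr mulr0 addr0 => GG.
have : e = d + d * (b - a) by rewrite /d; field; rewrite gt_eqF.
lra.
Unshelve. all: by end_near. Qed.

(* The derivative is defined everywhere but need not be continuous, so that
   continuous_FTC2 does not apply. *)
Lemma derivable_integrable_FTC2 (R : realType) (a b : R) (f h : R -> R) : a < b ->
  {within `[a, b], continuous h} ->
  (forall x, a < x < b -> is_derive x 1 h (f x)) ->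
  mu.-integrable `[a, b] (EFin \o f) ->
  \int[mu]_(x in `[a, b]) f x = h b - h a.
Proof.
move=> ab ch dh fi; apply/eqP; rewrite eq_le derivable_integrable_le// andbT.
have Nfi : mu.-integrable `[a, b] (EFin \o (- f)) by exact: integrableN fi.
have : - h b - - h a <= \int[mu]_(x in `[a, b]) - f x.
  apply: (@derivable_integrable_le R a b (- f) (fun x => - h x)) => //.
    by move=> s; apply: cvgN; exact: ch.
  by move=> x /dh ?; exact: is_deriveN.
have -> : \int[mu]_(x in `[a, b]) - f x = - \int[mu]_(x in `[a, b]) f x.
  rewrite -mulN1r -RintegralZl//.
  by apply: eq_Rintegral => x _; rewrite mulN1r.
lra.
Qed.

(** * Convolution with an integrable kernel *)

Lemma lebesgue_measure_shift (R : realType) (c : R) (A : set R) : measurable A ->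
  pushforward mu ((fun u => u + c) : measurableTypeR R -> measurableTypeR R) A = mu A.
Proof.
move=> mA.
have mphi : measurable_fun setT ((fun u => u + c) : measurableTypeR R -> measurableTypeR R).
  by apply: measurable_funD => //; exact: measurable_cst.
pose phi : {mfun measurableTypeR R >-> measurableTypeR R} :=
  HB.pack ((fun u => u + c) : measurableTypeR R -> measurableTypeR R)
    (isMeasurableFun.Build _ _ _ _ _ mphi).
apply/esym.
apply: (@lebesgue_measure_unique R (pushforward mu phi)) => //= _ [[l r]] _ <-.
rewrite /pushforward (_ : phi @^-1` _ = `]l - c, r - c]%classic); last first.
  by apply/seteqP; split => x /=; rewrite !in_itv/= ltrBlDr lerBrDr.
rewrite /= !lebesgue_measure_itv/=.
by rewrite !lte_fin ltrD2r -!EFinD opprB addrA subrK.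
Qed.

Lemma lebesgue_measure_reflect (R : realType) (c : R) (A : set R) : measurable A ->
  pushforward mu ((fun u => c - u) : measurableTypeR R -> measurableTypeR R) A = mu A.
Proof.
move=> mA.
have mphi : measurable_fun setT ((fun u => c - u) : measurableTypeR R -> measurableTypeR R).
  by apply: measurable_funB => //; exact: measurable_cst.
pose phi : {mfun measurableTypeR R >-> measurableTypeR R} :=
  HB.pack ((fun u => c - u) : measurableTypeR R -> measurableTypeR R)
    (isMeasurableFun.Build _ _ _ _ _ mphi).
apply/esym.
apply: (@lebesgue_measure_unique R (pushforward mu phi)) => //= _ [[l r]] _ <-.
rewrite /pushforward (_ : phi @^-1` _ = `[c - r, c - l[%classic); last first.
  by apply/seteqP; split => x /=; rewrite !in_itv/= lerBlDl ltrBrDr -lerBlDr -ltrBrDl => /andP[-> ->].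
rewrite /= !lebesgue_measure_itv/=.
by rewrite !lte_fin ltrD2l ltrN2 -!EFinD; case: ifP => // _; congr (_%:E); ring.
Qed.

Lemma ge0_integral_shift (R : realType) (c : R) (f : R -> \bar R) :
  measurable_fun setT f -> (forall x, 0 <= f x)%E ->
  (\int[mu]_u f (u + c)%R = \int[mu]_u f u)%E.
Proof.
move=> mf f0.
have mphi : measurable_fun setT ((fun u => u + c) : measurableTypeR R -> measurableTypeR R).
  by apply: measurable_funD => //; exact: measurable_cst.
rewrite -[LHS](@ge0_integral_pushforward _ _ _ _ R _ mphi mu setT f)//.
by apply: eq_measure_integral => //= A mA _; exact: lebesgue_measure_shift.
Qed.

Lemma ge0_integral_reflect (R : realType) (c : R) (f : R -> \bar R) :
  measurable_fun setT f -> (forall x, 0 <= f x)%E ->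
  (\int[mu]_u f (c - u)%R = \int[mu]_u f u)%E.
Proof.
move=> mf f0.
have mphi : measurable_fun setT ((fun u => c - u) : measurableTypeR R -> measurableTypeR R).
  by apply: measurable_funB => //; exact: measurable_cst.
rewrite -[LHS](@ge0_integral_pushforward _ _ _ _ R _ mphi mu setT f)//.
by apply: eq_measure_integral => //= A mA _; exact: lebesgue_measure_reflect.
Qed.

Lemma measurable_fun_shift (R : realType) (c : R) (f : R -> R) :
  measurable_fun setT f -> measurable_fun setT (fun u : R => f (u + c)).
Proof.
move=> mf; apply: (measurableT_comp mf).
by apply: measurable_funD => //; exact: measurable_cst.
Qed.

Lemma measurable_fun_reflect (R : realType) (c : R) (f : R -> R) :
  measurable_fun setT f -> measurable_fun setT (fun u : R => f (c - u)).
Proof.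
move=> mf; apply: (measurableT_comp mf).
by apply: measurable_funB => //; exact: measurable_cst.
Qed.

Lemma integrable_shift (R : realType) (c : R) (f : R -> R) :
  measurable_fun setT f -> mu.-integrable setT (EFin \o f) ->
  mu.-integrable setT (EFin \o (fun u => f (u + c))).
Proof.
move=> mf /integrableP[_ fi]; apply/integrableP; split.
  by apply/measurable_EFinP; exact: measurable_fun_shift.
rewrite /= (@ge0_integral_shift R c (fun u => `|(f u)%:E|)%E)//.
by apply: measurableT_comp => //; exact/measurable_EFinP.
Qed.

Lemma integrable_reflect (R : realType) (c : R) (f : R -> R) :
  measurable_fun setT f -> mu.-integrable setT (EFin \o f) ->
  mu.-integrable setT (EFin \o (fun u => f (c - u))).
Proof.
move=> mf /integrableP[_ fi]; apply/integrableP; split.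
  by apply/measurable_EFinP; exact: measurable_fun_reflect.
rewrite /= (@ge0_integral_reflect R c (fun u => `|(f u)%:E|)%E)//.
by apply: measurableT_comp => //; exact/measurable_EFinP.
Qed.

Lemma Rintegral_shift (R : realType) (c : R) (f : R -> R) :
  measurable_fun setT f ->
  \int[mu]_u f (u + c) = \int[mu]_u f u.
Proof.
move=> mf; have mfE : measurable_fun setT (EFin \o f) by exact/measurable_EFinP.
rewrite /Rintegral integralE [in RHS]integralE; congr (fine (_ - _)%E).
  rewrite -[RHS](ge0_integral_shift c (measurable_funepos mfE));
    last by move=> x; exact: funepos_ge0.
  by apply: eq_integral => x _; rewrite !unlock.
rewrite -[RHS](ge0_integral_shift c (measurable_funeneg mfE));
  last by move=> x; exact: funeneg_ge0.
  by apply: eq_integral => x _; rewrite !unlock.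
Qed.

Lemma integrable_mul_bounded (R : realType) (f g : R -> R) (C : R) :
  measurable_fun setT f -> mu.-integrable setT (EFin \o f) ->
  measurable_fun setT g -> (forall x, `|g x| <= C) ->
  mu.-integrable setT (EFin \o (fun x => f x * g x)).
Proof.
move=> mf fi mg gC.
have C0 : 0 <= C by apply: le_trans (gC 0).
apply: (@le_integrable _ (measurableTypeR R) R mu _ _ _ (EFin \o (fun x => C * f x))) => //.
- by apply/measurable_EFinP; apply: measurable_funM.
- by move=> x _ /=; rewrite lee_fin !normrM mulrC (ger0_norm C0) ler_wpM2r.
- exact: (@integrableZl _ (measurableTypeR R) R mu setT measurableT C _ fi).
Qed.

Lemma EFin_fine_integralZl (R : realType) (r : R) (f : R -> R) :
  mu.-integrable setT (EFin \o f) ->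
  (\int[mu]_x (r * f x)%:E = (r * \int[mu]_x f x)%:E)%E.
Proof.
move=> fi; rewrite EFinM /Rintegral fineK.
  rewrite -(@integralZl _ (measurableTypeR R) R mu setT measurableT _ fi).
  by [].
exact: (@integrable_fin_num _ (measurableTypeR R) R mu setT measurableT _ fi).
Qed.

Lemma Fubini_convolution (R : realType) (K X Y : R -> R) (CX CY : R) :
  measurable_fun setT K -> mu.-integrable setT (EFin \o K) ->
  measurable_fun setT X -> (forall t, `|X t| <= CX) ->
  measurable_fun setT Y -> (forall t, `|Y t| <= CY) ->
  mu.-integrable setT (EFin \o Y) ->
  \int[mu]_t (X t * \int[mu]_s (K (t - s) * Y s)) =
  \int[mu]_s (Y s * \int[mu]_t (K (t - s) * X t)).
Proof.
move=> mK Ki mX XC mY YC Yi.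
have KYi t : mu.-integrable setT (EFin \o (fun s => K (t - s) * Y s)).
  apply: (integrable_mul_bounded _ _ mY YC).
  - exact: measurable_fun_reflect.
  - exact: integrable_reflect.
have KXi s : mu.-integrable setT (EFin \o (fun t => K (t - s) * X t)).
  apply: (integrable_mul_bounded _ _ mX XC).
  - exact: measurable_fun_shift.
  - exact: integrable_shift.
pose f (z : measurableTypeR R * measurableTypeR R) : \bar R :=
  (X z.1 * (K (z.1 - z.2) * Y z.2))%:E.
have mf : measurable_fun setT f.
  apply/measurable_EFinP; apply: measurable_funM.
    by apply: measurableT_comp.
  apply: measurable_funM; last by apply: measurableT_comp.
  apply: (measurableT_comp mK); exact: measurable_funB.
pose muR : {sigma_finite_measure set (measurableTypeR R) -> \bar R} := @lebesgue_measure R.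
have f_integrable : (muR \x muR)%E.-integrable setT f.
  apply/(@integrable21ltyP _ _ (measurableTypeR R) (measurableTypeR R) R muR muR f mf) => /=.
  have CX0 : 0 <= CX by apply: le_trans (XC 0).
  have /integrableP[_ K1] := Ki; have /integrableP[_ Y1] := Yi.
  have mKa : measurable_fun setT (fun u : R => `|K u|%:E : \bar R).
    by apply/measurable_EFinP; exact: measurableT_comp.
  have mYa : measurable_fun setT (fun u : R => `|Y u|%:E : \bar R).
    by apply/measurable_EFinP; exact: measurableT_comp.
  have mKs s : measurable_fun setT (fun t : R => `|K (t - s)|%:E : \bar R).
    apply/measurable_EFinP; apply: measurableT_comp => //.
    exact: (measurable_fun_shift (- s) mK).
  apply: (@le_lt_trans _ _ (\int[muR]_s (`|Y s|%:E *
      (CX%:E * \int[muR]_u `|K u|%:E)))%E); last first.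
    rewrite ge0_integralZr//=; last first.
      by rewrite mule_ge0// ?lee_fin// integral_ge0.
    rewrite lte_mul_pinfty//.
      + exact: integral_ge0.
      + by rewrite ge0_fin_numE// integral_ge0.
      + by rewrite lte_mul_pinfty// ?lee_fin.
  apply: ge0_le_integral => //=.
  - by move=> s _; exact: integral_ge0.
  - have mfa : measurable_fun setT (abse \o f) by exact: measurableT_comp.
    exact: (@measurable_fun_fubini_tonelli_G _ _ _ _ _ muR _ mfa (fun z => abse_ge0 (f z))).
  - by apply: emeasurable_funM => //; exact: measurable_cst.
  - move=> s _; rewrite muleA -EFinM.
    rewrite -(@ge0_integral_shift R (- s) (fun u => `|K u|%:E)%E)//.
    rewrite -ge0_integralZl//=; [|exact: mKs|by rewrite lee_fin mulr_ge0].
    have mXKY : measurable_fun setT (fun t : R => `|X t * (K (t - s) * Y s)|%:E : \bar R).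
      apply/measurable_EFinP; apply: measurableT_comp => //.
      apply: measurable_funM => //; apply: measurable_funM; last exact: measurable_cst.
      exact: (measurable_fun_shift (- s) mK).
    apply: ge0_le_integral => //=.
    - exact: (measurable_funeM _ (mKs s)).
    - move=> t _; rewrite -EFinM lee_fin !normrM mulrA mulrAC.
      by rewrite ler_wpM2r// mulrC ler_wpM2l.
have := @Fubini _ _ (measurableTypeR R) (measurableTypeR R) R muR muR f f_integrable.
rewrite /f /= => H.
rewrite /Rintegral.
transitivity (fine (\int[muR]_x \int[muR]_y (X x * (K (x - y) * Y y))%:E)%E).
  congr fine; apply: eq_integral => t _.
  rewrite [RHS](EFin_fine_integralZl _ (KYi t)).
  by [].
rewrite H; congr fine; apply: eq_integral => s _.
rewrite -(EFin_fine_integralZl _ (KXi s)); apply: eq_integral => t _.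
by congr (_%:E); ring.
Qed.

Lemma within_continuous_extension (R : realType) (a b : R) (x : R -> R) : a <= b ->
  {within `[a, b], continuous x} ->
  exists X : R -> R, [/\ continuous X, {in `[a, b], X =1 x} &
    exists C : R, forall t, `|X t| <= C].
Proof.
move=> ab cx.
pose c (t : R) := Num.max a (Num.min t b).
have cab t : c t \in `[a, b].
  by rewrite in_itv/= /c le_max lexx/= ge_max ab ge_min lexx orbT.
have cc : continuous c.
  move=> t; apply: (@continuous_max _ _ (cst a) (fun u => Num.min u b)).
    exact: cvg_cst.
  by apply: (@continuous_min _ _ id (cst b)); [exact: cvg_id|exact: cvg_cst].
have cE t : t \in `[a, b] -> c t = t.
  by rewrite in_itv/= /c => /andP[at_ tb]; rewrite (min_idPl tb) (max_idPr at_).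
exists (x \o c); split.
- move=> t; have /subspace_continuousP/(_ (c t) (cab t)) := cx.
  apply: cvg_trans => A /=; rewrite /nbhs/= => wA.
  have Pc : \forall u \near t, `[a, b]%classic (c u) -> A (x (c u)).
    exact: (cc t _ wA).
  suff : \forall u \near t, A (x (c u)) by [].
  by apply: filterS Pc => u; apply; exact: cab.
- by move=> t /cE /= ->.
- have cn : {within `[a, b], continuous (fun t => `|x t|)}.
    by move=> t; apply: cvg_norm; exact: cx.
  have [d dab dmax] := EVT_max ab cn.
  by exists `|x d| => t; exact: dmax.
Qed.

Lemma cvg_Rintegral_convolution (R : realType) (K X : R -> R) (C : R) :
  measurable_fun setT K -> mu.-integrable setT (EFin \o K) ->
  continuous X -> (forall t, `|X t| <= C) ->
  continuous (fun s => \int[mu]_u (K u * X (u + s))).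
Proof.
move=> mK Ki cX XC s.
have mX : measurable_fun setT X by exact: continuous_measurable_fun.
have := @continuity_under_integral R _ (measurableTypeR R) mu
  (fun s u => K u * X (u + s)) setT measurableT (s - 1) (s + 1).
have sI : s \in `](s - 1), (s + 1)[%classic.
  by rewrite inE/= in_itv/= ltrBlDr ltrDl ltr01.
move=> /(_ _ _ (fun u => C * `|K u|) _ _ s sI); apply.
- move=> r _; apply: (integrable_mul_bounded mK Ki _ (fun u => XC (u + r))).
  exact: measurable_fun_shift.
- apply: aeW => u _ r _; apply: cvgM; first exact: cvg_cst.
  apply: (@cvg_comp _ _ _ (fun v => u + v) X); last exact: cX.
  by apply: cvgD; [exact: cvg_cst|exact: cvg_id].
- apply: (@integrableZl _ (measurableTypeR R) R mu setT measurableT C (EFin \o (fun u => `|K u|))).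
  exact: integrable_norm.
- by move=> r _; apply: aeW => u _ /=; rewrite normrM mulrC ler_wpM2r.
Qed.

Lemma measurable_integrable_patch (R : realType) (D : set R) (f : R -> R) :
  measurable D -> mu.-integrable D (EFin \o f) ->
  measurable_fun setT (f \_ D) /\ mu.-integrable setT (EFin \o (f \_ D)).
Proof.
move=> mD fi.
have mf : measurable_fun D f by apply/measurable_EFinP; exact: (measurable_int _ fi).
split; first exact/(measurable_restrictT _ mD).
rewrite -restrict_EFin.
exact: (iffLR (@integrable_mkcond _ (measurableTypeR R) R mu D _ mD) fi).
Qed.

Lemma Rintegral_right_convolution (R : realType) (a b s : R) (k x : R -> R) :
  s \in `[a, b] ->
  \int[mu]_(t in `[s, b]) (k (t - s) * x t) =
  \int[mu]_t ((k \_ `[0, b - a]) (t - s) * (x \_ `[a, b]) t).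
Proof.
rewrite in_itv/= => /andP[as_ sb].
rewrite Rintegral_mkcond; apply: eq_Rintegral => t _; rewrite !patchE.
rewrite !mem_setE !in_itv/= subr_ge0 lerBlDr.
have [st|ts] := leP s t; last by rewrite mul0r.
rewrite (le_trans as_ st)/=; have [tb|bt] := leP t b; last by rewrite mulr0.
by rewrite ifT// (le_trans tb)// -lerBlDl opprB addrCA subrr addr0.
Qed.

Lemma Rintegral_left_convolution (R : realType) (a b t : R) (k x : R -> R) :
  t \in `[a, b] ->
  \int[mu]_(s in `[a, t]) (k (t - s) * x s) =
  \int[mu]_s ((k \_ `[0, b - a]) (t - s) * (x \_ `[a, b]) s).
Proof.
rewrite in_itv/= => /andP[at_ tb].
rewrite Rintegral_mkcond; apply: eq_Rintegral => s _; rewrite !patchE.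
rewrite !mem_setE !in_itv/= subr_ge0.
have [as_|sa] /= := leP a s; last by rewrite mulr0.
have [st|ts] /= := leP s t; last by rewrite mul0r.
by rewrite (le_trans st tb) lerB.
Qed.

Lemma continuous_right_convolution (R : realType) (a b : R) (k x : R -> R) :
  a < b -> mu.-integrable `[0, b - a] (EFin \o k) ->
  {within `[a, b], continuous x} ->
  {within `[a, b], continuous (fun s => \int[mu]_(t in `[s, b]) (k (t - s) * x t))}.
Proof.
move=> ab ki cx.
have [mK Ki] := measurable_integrable_patch (measurable_itv _) ki.
set K := k \_ `[0, b - a] in mK Ki.
have [X [cX Xx [C XC]]] := within_continuous_extension (ltW ab) cx.
pose w v := X (Num.min v b) - X b.
have cw : continuous w.
  move=> v; apply: cvgB; last exact: cvg_cst.
  apply: (@cvg_comp _ _ _ (fun u => Num.min u b) X); last exact: cX.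
  by apply: (@continuous_min _ _ id (cst b)); [exact: cvg_id|exact: cvg_cst].
have wC v : `|w v| <= C + C by apply: (le_trans (ler_normB _ _)); exact: lerD.
have mw : measurable_fun setT w by exact: continuous_measurable_fun.
have KwI s : mu.-integrable setT (EFin \o (fun u => K u * w (u + s))).
  apply: (integrable_mul_bounded mK Ki _ (fun u => wC (u + s))).
  exact: measurable_fun_shift.
have KI z : measurable_fun setT (K \_ `[-1, z]) /\ mu.-integrable setT (EFin \o (K \_ `[-1, z])).
  apply: measurable_integrable_patch; first exact: measurable_itv.
  by apply: (@integrableS _ (measurableTypeR R) R mu setT).
have FE : {in `[a, b]%classic, (fun s => \int[mu]_u (K u * w (u + s)) +
    X b * \int[mu]_(u in `[-1, b - s]) K u) =1
    (fun s => \int[mu]_(t in `[s, b]) (k (t - s) * x t))}.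
  move=> s; rewrite inE/= => sab; rewrite (Rintegral_right_convolution _ _ sab) -/K.
  have -> : x \_ `[a, b] = X \_ `[a, b].
    by apply/funext => t; rewrite !patchE; case: ifPn => //; rewrite inE => /Xx.
  rewrite -[RHS](Rintegral_shift s).
    rewrite [X in _ + _ * X = _]Rintegral_mkcond -RintegralZl//; last exact: (KI _).2.
    rewrite -RintegralD//; last first.
      exact: (@integrableZl _ (measurableTypeR R) R mu setT measurableT (X b) _ (KI _).2).
    apply: eq_Rintegral => u _; rewrite addrK.
    rewrite /K !patchE !mem_setE !in_itv/=; case: ifPn => [/andP[u0 uba]|_]; last first.
      by rewrite !mul0r if_same mulr0 addr0.
    have -> : -1 <= u by apply: le_trans u0; rewrite oppr_le0 ler01.
    have -> : a <= u + s by move: sab; rewrite in_itv/= => /andP[? _]; rewrite ler_wpDl.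
    rewrite /= lerBrDr /w; have [usb|bus] := leP (u + s) b.
      by rewrite mulrC -mulrDl subrK mulrC.
    by rewrite subrr !mulr0 addr0.
  apply: measurable_funM; first exact: (measurable_fun_shift (- s) mK).
  apply/(measurable_restrictT _ (measurable_itv _)).
  by apply: measurable_funTS; exact: continuous_measurable_fun.
apply: (subspace_eq_continuous FE) => s.
apply: continuous_in_subspaceT => r; rewrite inE/= in_itv/= => /andP[ar rb].
apply: cvgD; first exact: (cvg_Rintegral_convolution mK Ki cw wC).
apply: cvgM; first exact: cvg_cst.
have cN : (fun u : R => b - u) u @[u --> r] --> b - r.
  by apply: cvgB; [exact: cvg_cst|exact: cvg_id].
have L : -1 < b - a + 1 by lra.
have /(continuous_within_itvP _ L)[cI _ _] := parameterized_integral_continuous (ltW L)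
  (@integrableS _ (measurableTypeR R) R mu setT _ _ measurableT (measurable_itv _) (@subsetT _ _) Ki).
apply: (@cvg_comp _ _ _ (fun u => b - u) (fun z => parameterized_integral mu (-1) z K) _ _ _ cN).
by apply: cI; rewrite in_itv/=; lra.
Qed.

Lemma within_derivative_continuous (R : realType) (a b : R) (y dy : R -> R) :
  (forall t, t \in `[a, b] ->
    (fun s => (y s - y t) / (s - t)) @ within `[a, b] t^' --> dy t) ->
  {within `[a, b], continuous y}.
Proof.
move=> hy; apply/subspace_continuousP => t tab; apply/cvgrPdist_lt => e e0.
have /cvgrPdist_lt/(_ 1 ltr01)[/= r r0 hr] := hy t tab.
have D0 : 0 < `|dy t| + 1 by rewrite ltr_wpDl.
exists (Num.min r (e / (`|dy t| + 1))) => /=.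
  by rewrite lt_min r0/= divr_gt0.
move=> s; rewrite /= lt_min => /andP[tsr tse] sab.
have [->|st] := eqVneq s t; first by rewrite subrr normr0.
have /= q1 : `|dy t - (y s - y t) / (s - t)| < 1 by apply: hr => //=.
have st0 : s - t != 0 by rewrite subr_eq0.
have q2 : `|(y s - y t) / (s - t)| < `|dy t| + 1.
  rewrite -ltrBlDl; apply: le_lt_trans q1.
  by rewrite distrC; apply: lerB_dist.
rewrite distrC -(divfK st0 (y s - y t)) normrM.
apply: (@le_lt_trans _ _ ((`|dy t| + 1) * `|s - t|)).
  by rewrite ler_wpM2r// ltW.
by rewrite mulrC -ltr_pdivlMr// distrC.
Qed.

Lemma within_derivative_is_derive (R : realType) (a b : R) (y dy : R -> R) :
  (forall t, t \in `[a, b] ->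
    (fun s => (y s - y t) / (s - t)) @ within `[a, b] t^' --> dy t) ->
  forall t, a < t < b -> is_derive t 1 y (dy t).
Proof.
move=> hy t /andP[at_ tb].
have tab : t \in `[a, b] by rewrite in_itv/= !ltW.
have cq : (fun h : R => h^-1 *: ((y \o shift t) (h *: 1) - y t)) @ 0^' --> dy t.
  apply/cvgrPdist_lt => e e0.
  have /cvgrPdist_lt/(_ e e0)[/= r r0 hr] := hy t tab.
  exists (Num.min r (Num.min (t - a) (b - t))) => /=.
    by rewrite !lt_min r0 !subr_gt0 at_.
  move=> h; rewrite /= sub0r normrN !lt_min => /and3P[hr1 hr2 hr3] h0.
  rewrite /GRing.scale/= mulr1 mulrC.
  have := hr (h + t); rewrite /= addrK; apply.
  - by rewrite opprD addrCA subrr addr0 normrN.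
  - by rewrite -subr_eq0 addrK.
  - rewrite in_itv/=; move: hr2 hr3; rewrite !ltr_norml => /andP[? ?] /andP[? ?].
    by lra.
by apply: DeriveDef; [apply/cvg_ex; exists (dy t)|exact: cvg_lim].
Qed.

Lemma kernel_integration_by_parts (R : realType) (a b : R) (k x y dy : R -> R)
    (F := fun s => \int[mu]_(t in `[s, b]) (k (t - s) * x t)) :
  a < b -> mu.-integrable `[0, b - a] (EFin \o k) -> k 0 = 0 ->
  {within `[a, b], continuous x} -> {within `[a, b], continuous dy} ->
  (forall t, t \in `[a, b] ->
    (fun s => (y s - y t) / (s - t)) @ within `[a, b] t^' --> dy t) ->
  (forall t, t \in `]a, b[ -> derivable F t 1) ->
  mu.-integrable `[a, b] (EFin \o (fun t => y t * derive1 F t)) ->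
  \int[mu]_(t in `[a, b])
    (x t * \int[mu]_(s in `[a, t]) (k (t - s) * derive1 y s)) =
  y b * F b - y a * F a - \int[mu]_(t in `[a, b]) (y t * derive1 F t).
Proof.
move=> ab ki k0 cx cdy hy dF yFi.
have cF : {within `[a, b], continuous F} by exact: continuous_right_convolution.
have cy := within_derivative_continuous hy.
have dy1 t : a < t < b -> derive1 y t = dy t.
  by move=> /(within_derivative_is_derive hy) [_ <-]; rewrite derive1E.
have dyFi : mu.-integrable `[a, b] (EFin \o (fun t => dy t * F t)).
  apply: continuous_compact_integrable; first exact: segment_compact.
  by move=> t; apply: cvgM; [exact: cdy|exact: cF].
have <- : \int[mu]_(t in `[a, b]) (dy t * F t + y t * derive1 F t) = y b * F b - y a * F a.
  apply: (@derivable_integrable_FTC2 R a b _ (fun t => y t * F t) ab).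
  - by move=> t; apply: cvgM; [exact: cy|exact: cF].
  - move=> t atb; have dyt := within_derivative_is_derive hy atb.
    have dFt : is_derive t 1 F (derive1 F t).
      by apply: DeriveDef; [apply: dF; rewrite in_itv|rewrite derive1E].
    apply: is_derive_eq; rewrite addrC mulrC.
    by congr (_ + _); rewrite /GRing.scale/= mulrC.
  - exact: (@integrableD _ (measurableTypeR R) R mu _ (measurable_itv _) _ _ dyFi yFi).
rewrite RintegralD//= addrK.
have [mK Ki] := measurable_integrable_patch (measurable_itv _) ki.
set K := k \_ `[0, b - a] in mK Ki.
have patchC (z : R -> R) : {within `[a, b], continuous z} ->
  [/\ measurable_fun setT (z \_ `[a, b]), mu.-integrable setT (EFin \o (z \_ `[a, b])) &
   exists C : R, forall t, `|(z \_ `[a, b]) t| <= C].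
  move=> cz.
  have [] := @measurable_integrable_patch R `[a, b] z (measurable_itv _).
    by apply: continuous_compact_integrable; first exact: segment_compact.
  move=> mz zi; split => //.
  have [Z [_ Zz [C ZC]]] := within_continuous_extension (ltW ab) cz.
  exists C => t; rewrite patchE; case: ifPn; last by rewrite normr0 (le_trans _ (ZC t)).
  by rewrite inE => tab; rewrite -Zz.
have [mX _ [CX XC]] := patchC _ cx.
have [mY Yi [CY YC]] := patchC _ cdy.
have := Fubini_convolution mK Ki mX XC mY YC Yi.
have -> : \int[mu]_(t in `[a, b]) (x t * \int[mu]_(s in `[a, t]) (k (t - s) * derive1 y s)) =
  \int[mu]_t ((x \_ `[a, b]) t * \int[mu]_s (K (t - s) * (dy \_ `[a, b]) s)).
  rewrite Rintegral_mkcond; apply: eq_Rintegral => t _.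
  rewrite !patchE; case: ifPn => [|_]; last by rewrite mul0r.
  rewrite inE => tab; congr (_ * _); rewrite -(Rintegral_left_convolution _ _ tab).
  have [at_ tb] : a <= t /\ t <= b by move: tab; rewrite /= in_itv/= => /andP.
  have mKY : measurable_fun setT (fun s : R => K (t - s) * (dy \_ `[a, b]) s).
    by apply: measurable_funM => //; exact: measurable_fun_reflect.
  have mk : measurable_fun `]a, t] (fun s => (k (t - s) * dy s)%:E).
    apply/measurable_EFinP.
    apply: (eq_measurable_fun _ _ (measurable_funTS mKY)) => s.
    rewrite inE/= in_itv/= => /andP[as_ st]; rewrite /K !patchE !mem_setE !in_itv/=.
    by rewrite subr_ge0 st (ltW as_) (le_trans st tb) lerB// ltW.
  have E1 s : s \in `]a, t]%classic -> k (t - s) * dy s = k (t - s) * derive1 y s.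
    rewrite inE/= in_itv/= => /andP[as_]; rewrite le_eqVlt => /predU1P[->|st].
      by rewrite subrr k0 !mul0r.
    by rewrite dy1// as_ (lt_le_trans st tb).
  rewrite /Rintegral -integral_itv_obnd_cbnd; last first.
    by apply: (eq_measurable_fun _ _ mk) => s /E1 ->.
  rewrite -[in RHS]integral_itv_obnd_cbnd//; congr fine.
  by apply: eq_integral => s sat; rewrite E1.
have -> : \int[mu]_(t in `[a, b]) (dy t * F t) =
  \int[mu]_s ((dy \_ `[a, b]) s * \int[mu]_t (K (t - s) * (x \_ `[a, b]) t)).
  rewrite Rintegral_mkcond; apply: eq_Rintegral => s _.
  rewrite !patchE; case: ifPn => [|_]; last by rewrite mul0r.
  by rewrite inE => sab; rewrite -(Rintegral_right_convolution _ _ sab).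
by [].
Qed.

(** * The analytic kernel *)

Lemma integrable_powR (R : realType) (p L : R) : 0 < p -> 0 < L ->
  mu.-integrable `[0, L] (EFin \o (fun u => u `^ (p - 1))).
Proof.
move=> p0 L0.
pose f (u : R) := u `^ (p - 1).
have mf : measurable_fun setT f by exact: measurable_powR.
pose D : set R := `]0, L]%classic.
have mD : measurable D by exact: measurable_itv.
pose e n : R := L / n.+2%:R.
have e0 n : 0 < e n by rewrite divr_gt0.
have eL n : e n < L by rewrite ltr_pdivrMr// ltr_pMr// ltr1n.
have ie n m : (n <= m)%N -> e m <= e n.
  by move=> nm; rewrite ler_pM2l// lef_pV2 ?posrE// ler_nat !ltnS.
pose g n (u : R) := (f u * \1_`[e n, +oo[%classic u)%:E : \bar R.
have g0 n u : (0 <= g n u)%E by rewrite lee_fin mulr_ge0// powR_ge0.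
have mg n : measurable_fun D (g n).
  apply/measurable_EFinP; apply: measurable_funM; first exact: measurable_funTS.
  exact: (measurable_indic (measurable_itv _)).
have hg (u : R) : D u -> {homo g ^~ u : n m / (n <= m)%N >-> (n <= m)%E}.
  move=> _ n m nm; rewrite lee_fin ler_wpM2l ?powR_ge0//.
  rewrite !indicE !mem_setE !in_itv/= !andbT ler_nat.
  by have [/(le_trans (ie _ _ nm)) ->|] := leP (e n) u.
have lg (u : R) : D u -> limn (g ^~ u) = (f u)%:E.
  rewrite /D/= in_itv/= => /andP[u0 uL]; apply: (@lim_near_cst _ _ _ _ _ (f u)%:E) => //.
  near=> n; rewrite /g indicE mem_set ?mulr1//= in_itv/= andbT /e.
  rewrite ler_pdivrMr// -ler_pdivrMl// mulrC.
  apply: (@le_trans _ _ n%:R); last by rewrite ler_nat leqW.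
  near: n; exact: nbhs_infty_ger.
have intg n : (\int[mu]_(u in D) g n u <= (L `^ p / p)%:E)%E.
  have -> : (\int[mu]_(u in D) g n u = \int[mu]_(u in `[e n, L]) (f u)%:E)%E.
    rewrite [LHS]integral_mkcond [RHS]integral_mkcond; apply: eq_integral => u _.
    rewrite !patchE /g /D indicE !mem_setE !in_itv/= andbT.
    have [enu|uen] /= := leP (e n) u; last by rewrite mulr0 if_same.
    by rewrite mulr1 (lt_le_trans (e0 n) enu).
  have dF u : e n <= u -> is_derive u 1 (fun u => p^-1 * u `^ p) (f u).
    move=> eu; have u0 : 0 < u by exact: lt_le_trans eu.
    have H := is_derive1_powR p u0.
    apply: is_derive_eq.
    by rewrite /GRing.scale/= /f; field; rewrite ?gt_eqF.
  have cF u : e n <= u -> {for u, continuous (fun u => p^-1 * u `^ p)}.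
    by move=> /dF[du _]; apply: differentiable_continuous; exact/derivable1_diffP.
  rewrite (@continuous_FTC2 R f (fun u => p^-1 * u `^ p) (e n) L (eL n)).
  - rewrite -EFinD lee_fin mulrC lerBlDr lerDl mulr_ge0// ?invr_ge0 ?powR_ge0 ?ltW//.
  - apply: derivable_within_continuous => u; rewrite in_itv/= => /andP[eu _].
    apply: derivable_powR; rewrite in_itv/= andbT; exact: lt_le_trans eu.
  - split.
    + by move=> u; rewrite in_itv/= => /andP[/ltW/dF[]].
    + by apply: cvg_at_right_filter; exact: (cF (e n)).
    + by apply: cvg_at_left_filter; apply: cF; exact: ltW.
  - move=> u; rewrite in_itv/= => /andP[/ltW/dF H _].
    by rewrite derive1E derive_val.
have : (\int[mu]_(u in D) (f u)%:E <= (L `^ p / p)%:E)%E.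
  have cv := @cvg_monotone_convergence _ (measurableTypeR R) R mu D mD g mg
    (fun n u _ => g0 n u) hg.
  have -> : (\int[mu]_(u in D) (f u)%:E = \int[mu]_(u in D) limn (g ^~ u))%E.
    by apply: eq_integral => u; rewrite inE => /lg ->.
  rewrite -(cvg_lim _ cv)//; apply: lime_le; first by apply/cvg_ex; eexists; exact: cv.
  exact: nearW.
move=> intf; apply/integrableP; split.
  by apply/measurable_EFinP; exact: measurable_funTS.
rewrite /= -integral_itv_obnd_cbnd; last first.
  have : measurable_fun D (fun u : R => `|f u|).
    by apply: measurableT_comp => //; exact: measurable_funTS.
  by move=> /measurable_EFinP.
under eq_integral do rewrite ger0_norm ?powR_ge0//.
by apply: (le_lt_trans intf); exact: ltry.
Unshelve. all: by end_near. Qed.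

Lemma power_series_cvg (K : numFieldType) (r : K) (c : nat -> K) (F : K -> K) (z : K) :
  power_series_on r c F -> `|z| < r ->
  \sum_(0 <= n < N) c n * z ^+ n @[N --> \oo] --> F z.
Proof.
move=> h zr; have [U Uz cU] := h z zr.
have zU : [set z] `<=` U by move=> w ->; exact: nbhs_singleton.
have := uniform_subset_cvg _ zU cU.
by rewrite uniform_set1; exact.
Qed.

Lemma ler_sum_geometric (K : numFieldType) (q : K) (N : nat) : 0 <= q -> q < 1 ->
  \sum_(0 <= n < N) q ^+ n <= (1 - q)^-1.
Proof.
move=> q0 q1; have q1' : 0 < 1 - q by rewrite subr_gt0.
rewrite -[leRHS]mul1r ler_pdivlMr//.
have -> : (\sum_(0 <= n < N) q ^+ n) * (1 - q) = 1 - q ^+ N.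
  elim: N => [|N IH]; first by rewrite big_nil mul0r expr0 subrr.
  by rewrite big_nat_recr//= mulrDl IH exprSr; ring.
by rewrite lerBlDr lerDl exprn_ge0.
Qed.

Lemma power_series_bounded (K : numFieldType) (r s : K) (c : nat -> K) (F : K -> K) :
  power_series_on r c F -> 0 <= s -> s < r ->
  exists M, forall z, `|z| <= s -> `|F z| <= M.
Proof.
move=> hF s0 sr; pose s1 := (s + r) / 2.
have ss1 : s < s1 by rewrite /s1 midf_lt.
have s1r : s1 < r by rewrite /s1 midf_lt.
have s10 : 0 < s1 by exact: le_lt_trans ss1.
have cs1 : \sum_(0 <= n < N) c n * s1 ^+ n @[N --> \oo] --> F s1.
  by apply: (power_series_cvg hF); rewrite gtr0_norm.
have [N0 _ hN0] : \forall N \near \oo, `|F s1 - \sum_(0 <= n < N) c n * s1 ^+ n| < 1.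
  by move/cvgrPdist_lt : cs1 => /(_ 1 ltr01).
pose C := 2 + \sum_(0 <= n < N0) `|c n * s1 ^+ n|.
have C0 : 0 <= C by rewrite addr_ge0// sumr_ge0.
have termC n : `|c n| * s1 ^+ n <= C.
  have -> : `|c n| * s1 ^+ n = `|c n * s1 ^+ n|.
    by rewrite normrM [X in _ = _ * X]ger0_norm// exprn_ge0// ltW.
  have [nN|Nn] := ltnP n N0.
    rewrite /C big_mkord (bigD1 (Ordinal nN))//= addrCA lerDl addr_ge0// sumr_ge0//.
  have -> : c n * s1 ^+ n = (F s1 - \sum_(0 <= k < n) c k * s1 ^+ k) -
     (F s1 - \sum_(0 <= k < n.+1) c k * s1 ^+ k).
    by rewrite big_nat_recr//=; ring.
  apply: (le_trans (ler_normB _ _)).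
  apply: (@le_trans _ _ (1 + 1)).
    by apply: lerD; apply/ltW/hN0 => //=; exact: leqW.
  by rewrite /C lerDl sumr_ge0.
pose q := s / s1.
have q0 : 0 <= q by rewrite divr_ge0// ltW.
have q1 : q < 1 by rewrite ltr_pdivrMr// mul1r.
exists (1 + C * (1 - q)^-1) => z zs.
have cz := power_series_cvg hF (le_lt_trans zs sr).
have [N hN] : exists N, `|F z - \sum_(0 <= n < N) c n * z ^+ n| < 1.
  by move/cvgrPdist_lt : cz => /(_ 1 ltr01)/filter_ex.
rewrite -[F z](subrK (\sum_(0 <= n < N) c n * z ^+ n)).
apply: (le_trans (ler_normD _ _)); apply: lerD; first exact: ltW.
apply: (le_trans (ler_norm_sum _ _ _)).
apply: (@le_trans _ _ (C * \sum_(0 <= n < N) q ^+ n)); last first.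
  by rewrite ler_wpM2l// ler_sum_geometric.
rewrite mulr_sumr; apply: ler_sum => n _.
rewrite normrM normrX; apply: (@le_trans _ _ (`|c n| * s ^+ n)).
  by rewrite ler_wpM2l// lerXn2r// nnegrE.
have -> : s = s1 * q by rewrite /q mulrCA divff ?mulr1// gt_eqF.
by rewrite exprMn mulrA ler_wpM2r// exprn_ge0.
Qed.

Lemma Re_mulC (R : realType) (z : R[i]) (r : R) : complex.Re (z * r%:C) = complex.Re z * r.
Proof. by case: z => u v /=; ring. Qed.

Lemma Im_mulC (R : realType) (z : R[i]) (r : R) : complex.Im (z * r%:C) = complex.Im z * r.
Proof. by case: z => u v /=; ring. Qed.

Lemma norm_Re_le (R : realType) (z M : R[i]) : `|z| <= M -> `|complex.Re z| <= complex.Re M.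
Proof.
move=> zM; have := le_trans (normc_ge_Re z) zM.
by rewrite lecE => /andP[].
Qed.

Lemma norm_Im_le (R : realType) (z M : R[i]) : `|z| <= M -> `|complex.Im z| <= complex.Re M.
Proof.
move=> zM; have := @norm_Re_le R (z * 'i%C) M.
rewrite ReiNIm normrN; apply.
by rewrite normrM [X in _ * X]normc_def /= expr0n expr1n add0r sqrtr1 mulr1.
Qed.

Lemma norm_cpow (R : realType) (u : R) (z : R[i]) : `|cpow u z| = (u `^ complex.Re z)%:C.
Proof.
rewrite /cpow normrM [X in _ * X]normc_def /= cos2Dsin2 sqrtr1 mulr1.
by rewrite normc_def /= expr0n addr0 sqrtr_sqr ger0_norm// powR_ge0.
Qed.

Definition cmeasurable (R : realType) (D : set R) (f : R -> R[i]) :=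
  measurable_fun D (fun u => complex.Re (f u)) /\
  measurable_fun D (fun u => complex.Im (f u)).

Lemma cmeasurable_cst (R : realType) (D : set R) (z : R[i]) : cmeasurable D (cst z).
Proof. by split; exact: measurable_cst. Qed.

Lemma cmeasurableD (R : realType) (D : set R) (f g : R -> R[i]) :
  cmeasurable D f -> cmeasurable D g -> cmeasurable D (fun u => f u + g u).
Proof.
move=> [fr fi] [gr gi]; split.
  apply: (eq_measurable_fun (fun u => complex.Re (f u) + complex.Re (g u))).
    by move=> u _; case: (f u) (g u) => ? ? [? ?].
  exact: measurable_funD.
apply: (eq_measurable_fun (fun u => complex.Im (f u) + complex.Im (g u))).
  by move=> u _; case: (f u) (g u) => ? ? [? ?].
exact: measurable_funD.
Qed.

Lemma cmeasurableM (R : realType) (D : set R) (f g : R -> R[i]) :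
  cmeasurable D f -> cmeasurable D g -> cmeasurable D (fun u => f u * g u).
Proof.
move=> [fr fi] [gr gi]; split.
  apply: (eq_measurable_fun (fun u => complex.Re (f u) * complex.Re (g u) -
      complex.Im (f u) * complex.Im (g u))).
    by move=> u _; case: (f u) (g u) => ? ? [? ?].
  by apply: measurable_funB; exact: measurable_funM.
apply: (eq_measurable_fun (fun u => complex.Re (f u) * complex.Im (g u) +
    complex.Im (f u) * complex.Re (g u))).
  by move=> u _; case: (f u) (g u) => ? ? [? ?].
by apply: measurable_funD; exact: measurable_funM.
Qed.

Lemma cmeasurable_poly (R : realType) (D : set R) (c : nat -> R[i]) (f : R -> R[i]) (N : nat) :
  cmeasurable D f -> cmeasurable D (fun u => \sum_(0 <= n < N) c n * f u ^+ n).
Proof.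
move=> mf.
have mX n : cmeasurable D (fun u => f u ^+ n).
  elim: n => [|n IH]; first exact: cmeasurable_cst.
  by under eq_fun do rewrite exprS; exact: cmeasurableM.
elim: N => [|N IH].
  by under eq_fun do rewrite big_nil; exact: cmeasurable_cst.
under eq_fun do rewrite big_nat_recr//=.
by apply: cmeasurableD => //; apply: cmeasurableM => //; exact: cmeasurable_cst.
Qed.

Lemma cmeasurable_cpow (R : realType) (D : set R) (z : R[i]) : cmeasurable D (fun u => cpow u z).
Proof.
apply: cmeasurableM.
  by split; [apply: measurable_funTS; exact: measurable_powR|exact: measurable_cst].
have mln : measurable_fun setT (fun u : R => complex.Im z * ln u).
  by apply: measurable_funM => //; exact: measurable_ln.
split; apply: measurable_funTS => /=.
  apply: (measurableT_comp _ mln).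
  by apply: continuous_measurable_fun; exact: continuous_cos.
apply: (measurableT_comp _ mln).
by apply: continuous_measurable_fun; exact: continuous_sin.
Qed.

Lemma cvg_Re_Im (R : realType) (f : nat -> R[i]) (l : R[i]) :
  (forall e : R[i], 0 < e -> \forall n \near \oo, `|l - f n| < e) ->
  complex.Re (f n) @[n --> \oo] --> complex.Re l /\
  complex.Im (f n) @[n --> \oo] --> complex.Im l.
Proof.
move=> fl; split; apply/cvgrPdist_le => e e0.
  have e0' : 0 < e%:C by rewrite ltcR.
  have := fl _ e0'; apply: filterS => n /ltW/norm_Re_le.
  by case: (l) (f n) => ? ? [? ?].
have e0' : 0 < e%:C by rewrite ltcR.
have := fl _ e0'; apply: filterS => n /ltW/norm_Im_le.
by case: (l) (f n) => ? ? [? ?].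
Qed.

Lemma cintegrable_analytic_kernel (R : realType) (p L : R) (beta : R[i]) (rho : R)
    (c : nat -> R[i]) (A : R[i] -> R[i]) :
  0 < p -> 0 < L -> 0 <= complex.Re beta -> L `^ complex.Re beta < rho ->
  power_series_on rho%:C c A ->
  cintegrable `[0, L] (fun u => (u `^ (p - 1))%:C * A (cpow u beta)).
Proof.
move=> p0 L0 b0 Lrho hA.
have [M MA] : exists M, forall z, `|z| <= (L `^ complex.Re beta)%:C -> `|A z| <= M.
  by apply: (power_series_bounded hA); rewrite ?ltcR// lecR powR_ge0.
have cL u : u \in `[0, L] -> `|cpow u beta| <= (L `^ complex.Re beta)%:C.
  rewrite in_itv/= => /andP[u0 uL]; rewrite norm_cpow lecR.
  by apply: ge0_ler_powR => //; rewrite nnegrE// ltW.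
have mA : cmeasurable `[0, L] (fun u => A (cpow u beta)).
  pose S N u := \sum_(0 <= n < N) c n * cpow u beta ^+ n.
  have mS N : cmeasurable `[0, L] (S N).
    exact/cmeasurable_poly/cmeasurable_cpow.
  have SA u : `[0, L]%classic u ->
      complex.Re (S n u) @[n --> \oo] --> complex.Re (A (cpow u beta)) /\
      complex.Im (S n u) @[n --> \oo] --> complex.Im (A (cpow u beta)).
    move=> uL; apply: cvg_Re_Im => e e0.
    have ur : `|cpow u beta| < rho%:C by apply: (le_lt_trans (cL u uL)); rewrite ltcR.
    by have /cvgrPdist_lt/(_ e e0) := power_series_cvg hA ur.
  split.
    apply: (@measurable_fun_cvg _ _ _ _ (fun N u => complex.Re (S N u))).
      by move=> N; case: (mS N).
    by move=> u /SA[].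
  apply: (@measurable_fun_cvg _ _ _ _ (fun N u => complex.Im (S N u))).
    by move=> N; case: (mS N).
  by move=> u /SA[].
have pi := integrable_powR p0 L0.
have bounded_mul (f : R -> R) : measurable_fun `[0, L] f ->
    (forall u, u \in `[0, L] -> `|f u| <= complex.Re M) ->
    mu.-integrable `[0, L] (EFin \o (fun u => u `^ (p - 1) * f u)).
  move=> mf fM.
  have M0 : 0 <= complex.Re M.
    by apply: le_trans (fM 0 _) => //; rewrite in_itv/= lexx ltW.
  apply: (@le_integrable _ (measurableTypeR R) R mu _ _ _
    (EFin \o (fun u => complex.Re M * u `^ (p - 1)))) => //.
  - apply/measurable_EFinP; apply: measurable_funM => //.
    by apply: measurable_funTS; exact: measurable_powR.
  - move=> u uL /=; rewrite lee_fin !normrM mulrC (ger0_norm M0).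
    by rewrite ler_wpM2r// fM.
  - exact: (@integrableZl _ (measurableTypeR R) R mu _ (measurable_itv _) _ _ pi).
have [mRe mIm] := mA.
split.
  have := bounded_mul _ mRe (fun u uL => norm_Re_le (MA _ (cL u uL))).
  apply: eq_integrable => // u _ /=.
  by congr (_%:E); case: (A _) => v w /=; ring.
have := bounded_mul _ mIm (fun u uL => norm_Im_le (MA _ (cL u uL))).
apply: eq_integrable => // u _ /=.
by congr (_%:E); case: (A _) => v w /=; ring.
Qed.

Lemma Gamma0 (R : realType) : Gamma (0 : R[i]) = 0.
Proof. by rewrite /Gamma /= ltxx invr0 mulr0. Qed.

Lemma conjugate_kernels_order (R : realType) (alpha : R) (beta : R[i])
    (c cbar : nat -> R[i]) :
  0 <= alpha <= 1 -> conjugate_kernels alpha beta c cbar -> 0 < alpha < 1.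
Proof.
move=> /andP[a0 a1] /(_ 0%N); rewrite big_ord1 /gamma_coef/= !mulr0 !add0r => h.
rewrite lt_def a0 andbT lt_neqAle a1 andbT; apply/andP; split; apply/eqP => ae.
  by move/eqP: h; rewrite ae Gamma0 mulr0 mul0r eq_sym oner_eq0.
by move/eqP: h; rewrite ae subrr Gamma0 mulr0 mulr0 eq_sym oner_eq0.
Qed.

Lemma complex_eq (R : realType) (z w : R[i]) :
  complex.Re z = complex.Re w -> complex.Im z = complex.Im w -> z = w.
Proof. by case: z w => ? ? [? ?] /= -> ->. Qed.

Theorem lemma10 (R : realType) (a b alpha : R) (beta : R[i]) (rho rhobar : R)
    (c cbar : nat -> R[i]) (A Abar : R[i] -> R[i]) (x y : R -> R)
    (hab : a < b)
    (halpha : 0 <= alpha <= 1)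
    (hbeta : 0 <= complex.Re beta)
    (hrho : 0 < rho /\ (b - a) `^ complex.Re beta < rho)
    (hA : power_series_on rho%:C c A)
    (hrhobar : 0 < rhobar /\ (b - a) `^ complex.Re beta < rhobar)
    (hAbar : power_series_on rhobar%:C cbar Abar)
    (hconj : conjugate_kernels alpha beta c cbar)
    (hx : {within `[a, b], continuous x})
    (hy : C1_on a b y)
    (hRL : RL_right_defined a b alpha beta Abar x)
    (hint : cintegrable `[a, b]
              (fun t => (y t)%:C * RL_right b alpha beta Abar x t)) :
  cintegral `[a, b] (fun t => (x t)%:C * caputo_left a alpha beta Abar y t) =
    ((y b)%:C * frac_int_right b (1 - alpha) beta Abar x b -
     (y a)%:C * frac_int_right b (1 - alpha) beta Abar x a) +
    cintegral `[a, b] (fun t => (y t)%:C * RL_right b alpha beta Abar x t).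
Proof.
have /andP[a0 a1] := conjugate_kernels_order halpha hconj.
have p0 : 0 < 1 - alpha by rewrite subr_gt0.
have ba0 : 0 < b - a by rewrite subr_gt0.
have [dy cdy hdy] := hy.
pose k u : R[i] := (u `^ (1 - alpha - 1))%:C * Abar (cpow u beta).
have k0 : k 0 = 0.
  rewrite /k powR0 ?mul0r//.
  by rewrite addrAC subrr add0r oppr_eq0 gt_eqF.
have [kRe kIm] : cintegrable `[0, b - a] k.
  exact: (cintegrable_analytic_kernel p0 ba0 hbeta hrhobar.2 hAbar).
pose F := frac_int_right b (1 - alpha) beta Abar x.
(* [P] stands for the real or the imaginary part. *)
have part (P : R[i] -> R) :
    (forall z w, P (z + w) = P z + P w) ->
    (forall z r, P (z * r%:C) = P z * r) ->
    (forall D f, P (cintegral D f) = \int[mu]_(s in D) P (f s)) ->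
    (forall f t, P (cderive f t) = derive1 (P \o f) t) ->
    mu.-integrable `[0, b - a] (EFin \o (P \o k)) ->
    (forall t, t \in `]a, b[ -> derivable (P \o F) t 1) ->
    mu.-integrable `[a, b]
      (EFin \o (fun t => P ((y t)%:C * RL_right b alpha beta Abar x t))) ->
    P (cintegral `[a, b] (fun t => (x t)%:C * caputo_left a alpha beta Abar y t)) =
    P (((y b)%:C * F b - (y a)%:C * F a) +
      cintegral `[a, b] (fun t => (y t)%:C * RL_right b alpha beta Abar x t)).
  move=> PD PZr Pint Pder ki dF yi.
  have PZ r z : P (r%:C * z) = r * P z by rewrite mulrC PZr mulrC.
  have PN z : P (- z) = - P z.
    by rewrite -[- z]mulrN1 -[-1](rmorphN1 (real_complex R)) PZr mulrN1.
  have FE : (fun s => \int[mu]_(t in `[s, b]) ((P \o k) (t - s) * x t)) = P \o F.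
    by apply/funext => s /=; rewrite Pint; apply: eq_Rintegral => t _; rewrite PZr.
  have RLE t : P ((y t)%:C * RL_right b alpha beta Abar x t) = - (y t * derive1 (P \o F) t).
    by rewrite PZ PN Pder mulrN.
  have yFi : mu.-integrable `[a, b] (EFin \o (fun t => y t * derive1 (P \o F) t)).
    have := @integrableN _ (measurableTypeR R) R mu _ _ yi.
    by apply: eq_integrable => // t _ /=; rewrite RLE opprK.
  have := @kernel_integration_by_parts R a b (P \o k) x y dy hab ki.
  have PBD u v w : P (u - v + w) = P u - P v + P w by rewrite !PD PN.
  rewrite FE => /(_ _ hx cdy hdy dF yFi) H.
  rewrite [RHS]PBD [X in _ = X - _ + _]PZ [X in _ = _ - X + _]PZ.
  rewrite [X in _ = _ + X]Pint [LHS]Pint.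
  under [X in _ = _ + X]eq_Rintegral do rewrite RLE.
  transitivity (\int[mu]_(t in `[a, b])
    (x t * \int[mu]_(s in `[a, t]) ((P \o k) (t - s) * derive1 y s))).
    apply: eq_Rintegral => t _; rewrite PZ Pint; congr (_ * _).
    by apply: eq_Rintegral => s _; rewrite PZr.
  have FEs s : \int[mu]_(t in `[s, b]) ((P \o k) (t - s) * x t) = P (F s).
    by rewrite -[RHS]/((P \o F) s) -FE.
  rewrite H ?FEs; last first.
    by rewrite /= k0 -[0](mulr0 1) -[X in _ * X](rmorph0 (real_complex R)) PZr mulr0.
  congr (_ + _); rewrite -mulN1r -RintegralZl//.
  by apply: eq_Rintegral => t _; rewrite mulN1r.
apply: complex_eq.
- apply: (part (@complex.Re R)) => //.
  + by case=> ? ? [? ?].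
  + exact: Re_mulC.
  + exact: (fun t tab => (hRL t tab).1).
  + exact: hint.1.
- apply: (part (@complex.Im R)) => //.
  + by case=> ? ? [? ?].
  + exact: Im_mulC.
  + exact: (fun t tab => (hRL t tab).2).
  + exact: hint.2.
Qed.
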